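(* Let $p_1,p_2,p_3$ satisfy $p_1=\infty$, $\frac1{p_2}+\frac1{p_3}=1$ and $1<p_2,p_3<\infty$, and let $C$ be any constant. Then there exist functions $F,G,H\in\mathcal{S}(\mathbb{R}^2)$, none of them identically zero, such that $$|\Lambda(F,G,H)|\ge C\,\|F\|_{L^\infty(\mathbb{R}^2)}\|G\|_{L^{p_2}(\mathbb{R}^2)}\|H\|_{L^{p_3}(\mathbb{R}^2)},$$ where $\Lambda$ is the triangular Hilbert form.
   Context: $\mathcal{S}(\mathbb{R}^2)$ denotes the Schwartz space. For $F,G,H\in\mathcal{S}(\mathbb{R}^{2})$ the triangular Hilbert form is $$\Lambda(F,G,H):=\operatorname{p.v.}\int_{\mathbb{R}^{3}}F(x,y)\,G(y,z)\,H(z,x)\,\frac{dx\,dy\,dz}{x+y+z},$$ where the principal value is the limit as $\varepsilon\to0^+$ of the integral restricted to $\varepsilon\le|x+y+z|\le\varepsilon^{-1}$. *)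

(* Defs.v *)
From HB Require Import structures.
From mathcomp Require Export all_boot all_order all_algebra.
From mathcomp Require Export complex.
From mathcomp Require Export all_classical all_reals all_analysis.

Set Implicit Arguments.
Unset Strict Implicit.
Unset Printing Implicit Defensive.

Import Order.TTheory GRing.Theory Num.Theory.
Import numFieldTopology.Exports numFieldNormedType.Exports.

Local Open Scope classical_set_scope.
Local Open Scope ring_scope.

(* The library has no derivative, no integral and no L^p norm for functions
   with values in R[i]. The first two are taken componentwise, and the L^p norm
   is the library's Lnorm of the modulus. No separate integrability condition
   is needed: for Schwartz functions the truncated integrand is integrable. *)

(* false is the first coordinate direction, true the second. *)
Definition basis_vec (R : realType) (b : bool) : R * R :=
  if b then (0, 1) else (1, 0).

(* The iterated partial derivative of u along the word w of directions. *)
Definition partials (R : realType) (w : seq bool) (u : R * R -> R) :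
    R * R -> R :=
  foldr (fun b (v : R * R -> R) p => 'D_(basis_vec R b) v p) u w.

(* 'D_v u is a default value when the derivative does not exist, hence the
   derivability requirement at every order. *)
Definition smooth (R : realType) (u : R * R -> R) : Prop :=
  forall (w : seq bool),
    continuous (partials w u) /\
    forall (b : bool) (p : R * R), derivable (partials w u) p (basis_vec R b).

Definition cpartials (R : realType) (w : seq bool) (F : R * R -> R[i]) :
    R * R -> R[i] :=
  fun p => (partials w (fun q => complex.Re (F q)) p
            +i* partials w (fun q => complex.Im (F q)) p)%C.

Definition schwartz (R : realType) (F : R * R -> R[i]) : Prop :=
  [/\ smooth (fun p => complex.Re (F p)),
      smooth (fun p => complex.Im (F p)) &
      forall (m n : nat) (w : seq bool), exists M : R, forall p : R * R,
        `|p.1 ^+ m * p.2 ^+ n| * Normc.normc (cpartials w F p) <= M].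

Definition leb2 (R : realType) :
    {measure set (measurableTypeR R * measurableTypeR R) -> \bar R} :=
  (@lebesgue_measure R \x @lebesgue_measure R)%E.

Definition leb3 (R : realType) :
    {measure set
      (measurableTypeR R * measurableTypeR R * measurableTypeR R) -> \bar R} :=
  ((@lebesgue_measure R \x @lebesgue_measure R) \x @lebesgue_measure R)%E.

Definition cLnorm (R : realType) (p : \bar R) (F : R * R -> R[i]) : \bar R :=
  Lnorm (@leb2 R) p (fun q => (Normc.normc (F q))%:E).

Definition cintegral3 (R : realType) (D : set (R * R * R))
    (f : R * R * R -> R[i]) : R[i] :=
  (Rintegral (@leb3 R) D (fun q => complex.Re (f q))
   +i* Rintegral (@leb3 R) D (fun q => complex.Im (f q)))%C.

Definition thf_integrand (R : realType) (F G H : R * R -> R[i])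
    (q : R * R * R) : R[i] :=
  let: (x, y, z) := q in
  F (x, y) * G (y, z) * H (z, x) / (x + y + z)%:C%C.

Definition thf_trunc (R : realType) (F G H : R * R -> R[i]) (eps : R) : R[i] :=
  cintegral3
    [set q : R * R * R | eps <= `|q.1.1 + q.1.2 + q.2| <= eps^-1]
    (thf_integrand F G H).

(* R[i]^o carries the topology of the complex modulus; R[i] itself has none in
   the library. *)
Definition thf (R : realType) (F G H : R * R -> R[i]) : R[i] :=
  lim ((thf_trunc F G H eps : R[i]^o) @[eps --> 0^'+]).

(* Main.v *)
Require Import Defs.
From mathcomp Require Import measurable_realfun ess_sup_inf ring lra.

Set Implicit Arguments.
Unset Strict Implicit.
Unset Printing Implicit Defensive.

Import Order.TTheory GRing.Theory Num.Theory.
Import numFieldTopology.Exports numFieldNormedType.Exports.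

Local Open Scope classical_set_scope.
Local Open Scope ring_scope.

(** Measure [F] in the sup norm only: then [F] may be comparable to [1] on the
    whole strip [1 < x + y < N], and the form tests whether
      [(x, y) |-> \int G (y, z) H (z, x) / (x + y + z) dz]
    is absolutely integrable. Let [G] and [H] be tensor products whose factor in
    [z] is a fixed bump on [(0, 1)] and whose factors in [y] and [x] are bumps
    of width comparable to [N]. The inner integral is then the Hilbert transform
    of a fixed nonnegative bump, evaluated at a point of size [x + y], and it
    is comparable to [1 / (x + y)]. Its integral over the part of the strip
    where [x] runs over an interval of length [N] is thus comparable to
    [N * log N], because all dyadic ranges of [x + y] between [1] and [N]
    contribute the same amount ([test_integral_ge]). On the other side, the
    exponents being conjugate, the norms of [G] and [H] multiply to at most
    [2 * N] ([test_norms_le]). A large [N] exceeds any given constant.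

    On the supports [x + y > 1] and [z > 0], so that the integrand is nonnegative
    and vanishes near the singular plane; it also has bounded support. The
    truncated integrals are therefore constant for small [eps], and the
    principal value is a plain integral ([thf_real]).

    The smooth cutoffs are products of [exp (- 1 / t)] composed with affine
    forms. They belong to an algebra of functions that is stable under partial
    derivatives ([flat_alg_derive]), which yields smoothness, and compact support
    yields the Schwartz bounds ([schwartz_bump]). *)

(** * Flat exponentials *)

(** [flat_exp 0] is the classical smooth function that is flat at [0]. The powers
    of [1 / t] are carried along because they are what differentiation of
    [exp (- 1 / t)] produces. *)
Definition flat_exp (R : realType) (k : nat) (t : R) : R :=
  if 0 < t then t^-1 ^+ k * expR (- t^-1) else 0.

Lemma flat_exp_pos (R : realType) k (t : R) :
  0 < t -> flat_exp k t = t^-1 ^+ k * expR (- t^-1).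
Proof. by rewrite /flat_exp => ->. Qed.

Lemma flat_exp_neg (R : realType) k (t : R) : t <= 0 -> flat_exp k t = 0.
Proof. by rewrite /flat_exp leNgt => /negbTE ->. Qed.

Lemma flat_exp_ge0 (R : realType) k (t : R) : 0 <= flat_exp k t.
Proof.
rewrite /flat_exp; case: ifP => // t0; apply: mulr_ge0; last exact: expR_ge0.
by apply: exprn_ge0; rewrite invr_ge0 ltW.
Qed.

(** Exponential decay beats every power of [1 / t]. The square is what makes the
    difference quotient at [0] tend to [0]; it comes from the term of degree
    [k + 2] of the exponential series at [1 / t]. *)
Lemma flat_exp_le_sqr (R : realType) k (t : R) :
  flat_exp k t <= (k.+2)`!%:R * t ^+ 2.
Proof.
have [t0|t0] := ltP 0 t; last first.
  by rewrite flat_exp_neg // mulr_ge0 // sqr_ge0.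
rewrite flat_exp_pos //; have s0 : 0 < t^-1 by rewrite invr_gt0.
have := expR_ge1Dxn k.+1 (ltW s0) => /(le_trans _).
move=> /(_ (t^-1 ^+ k.+2 / (k.+2)`!%:R)); rewrite lerDr ler01 => /(_ isT) h.
rewrite expRN ler_pdivrMr ?expR_gt0 //.
have -> : t^-1 ^+ k = t ^+ 2 * t^-1 ^+ k.+2.
  by rewrite -(addn2 k) exprD mulrCA -exprMn divff ?gt_eqF // expr1n mulr1.
rewrite -[leRHS]mulrA [leRHS]mulrCA ler_pM2l ?exprn_gt0 //.
by rewrite -ler_pdivrMl ?ltr0n ?fact_gt0 // mulrC.
Qed.

(** The family is closed under differentiation up to linear combinations. Away
    from [0] this is the product rule; at [0] both sides vanish, by
    [flat_exp_le_sqr]. *)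
Lemma is_derive_flat_exp (R : realType) k (t : R) :
  is_derive t 1 (flat_exp k) (flat_exp k.+2 t - k%:R * flat_exp k.+1 t).
Proof.
case: (ltgtP 0 t) => [t0|t0|<-].
- apply: (@near_eq_is_derive _ _ _ (fun s : R => s^-1 ^+ k * expR (- s^-1))).
    near=> s; rewrite flat_exp_pos //; near: s; exact: lt_nbhsr.
  have dV : is_derive t 1 (fun s : R => s^-1) (- t ^- 2).
    apply: is_derive_eq (is_deriveV (f := id) _ _) _; first by rewrite gt_eqF.
    by rewrite [_ *: _]mulr1.
  have dE : is_derive t 1 (fun s : R => expR (- s^-1)) (expR (- t^-1) * t ^- 2).
    have dN : is_derive t 1 (fun s : R => - s^-1) (- - t ^- 2) := is_deriveN dV.
    rewrite -[t ^- 2]opprK.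
    exact (is_derive1_comp (is_derive_expR _) dN).
  have dX : is_derive t 1 (fun s : R => s^-1 ^+ k)
      (k%:R * t^-1 ^+ k.-1 * (- t ^- 2)).
    have := is_deriveX k dV; rewrite exprfctE; exact.
  have dM : is_derive t 1 (fun s : R => s^-1 ^+ k * expR (- s^-1))
      (t^-1 ^+ k * (expR (- t^-1) * t ^- 2)
       + expR (- t^-1) * (k%:R * t^-1 ^+ k.-1 * (- t ^- 2))).
    exact (is_deriveM dX dE).
  rewrite !flat_exp_pos //.
  have <- : t^-1 ^+ k * (expR (- t^-1) * t ^- 2)
       + expR (- t^-1) * (k%:R * t^-1 ^+ k.-1 * (- t ^- 2)) =
    t^-1 ^+ k.+2 * expR (- t^-1) - k%:R * (t^-1 ^+ k.+1 * expR (- t^-1)).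
    rewrite -exprVn; case: k {dX dM} => [|k]; first by ring.
    by rewrite /= !exprS; ring.
  exact: dM.
- rewrite !flat_exp_neg ?(ltW t0) // mulr0 subr0.
  apply: (@near_eq_is_derive _ _ _ (cst 0)) => //.
  near=> s; rewrite flat_exp_neg // ltW //; near: s; exact: lt_nbhsl.
- rewrite !flat_exp_neg // mulr0 subr0.
  have lim0 : h^-1 *: ((flat_exp k \o shift 0) (h *: 1) - flat_exp k 0)
                @[h --> (0 : R)^'] --> (0 : R).
    apply/cvgr0Pnorm_le => e e0.
    near=> h.
    rewrite [(flat_exp k) 0]flat_exp_neg // subr0 /= addr0 [h *: 1]mulr1.
    rewrite normrM normfV (ger0_norm (flat_exp_ge0 _ _)).
    have h0 : 0 < `|h|.
      rewrite normr_gt0; near: h; exact: nbhs_dnbhs_neq.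
    rewrite mulrC ler_pdivrMr //; apply: le_trans (flat_exp_le_sqr _ _) _.
    rewrite -real_normK ?num_real // expr2 mulrA ler_pM2r //.
    rewrite -ler_pdivlMl ?ltr0n ?fact_gt0 //; near: h; apply: dnbhs0_le.
    by rewrite mulr_gt0 // invr_gt0 ltr0n fact_gt0.
  by apply: DeriveDef; [apply/cvg_ex; exists 0|exact: cvg_lim lim0].
Unshelve. all: by end_near. Qed.

Lemma continuous_flat_exp (R : realType) k : continuous (@flat_exp R k).
Proof.
move=> t; apply: differentiable_continuous; apply/derivable1_diffP.
exact: (@ex_derive _ _ _ _ _ _ _ (is_derive_flat_exp k t)).
Qed.

Lemma flat_exp0_homo (R : realType) (s t : R) :
  s <= t -> flat_exp 0 s <= flat_exp 0 t.
Proof.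
move=> st; have [s0|s0] := ltP 0 s; last by rewrite (flat_exp_neg _ s0) flat_exp_ge0.
have t0 := lt_le_trans s0 st; rewrite !flat_exp_pos // !expr0 !mul1r.
by rewrite ler_expR lerN2 lef_pV2.
Qed.

Lemma flat_exp0_le1 (R : realType) (t : R) : flat_exp 0 t <= 1.
Proof.
have [t0|t0] := ltP 0 t; last by rewrite flat_exp_neg // ler01.
by rewrite flat_exp_pos // expr0 mul1r expR_le1 oppr_le0 invr_ge0 ltW.
Qed.

Lemma flat_exp0_gt0 (R : realType) (t : R) : 0 < t -> 0 < flat_exp 0 t.
Proof. by move=> t0; rewrite flat_exp_pos // expr0 mul1r expR_gt0. Qed.

(** * Smoothness by closure under partial derivatives *)

(** A class of functions of two variables that each partial derivative maps to
    itself: every member is then smooth, with no higher-order calculus. It is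
    an inductive predicate because membership of the derivative has to be
    tracked along the product rule. *)
Inductive flat_alg (R : realType) : (R * R -> R) -> Prop :=
| flat_alg_flat_exp k (a b c : R) :
    flat_alg (fun p => flat_exp k (a * p.1 + b * p.2 + c))
| flat_alg_scale (a : R) u : flat_alg u -> flat_alg (fun p => a * u p)
| flat_alg_add u v : flat_alg u -> flat_alg v -> flat_alg (fun p => u p + v p)
| flat_alg_mul u v : flat_alg u -> flat_alg v -> flat_alg (fun p => u p * v p).

(** Directional derivatives are one-variable derivatives along a line, so the
    one-variable chain rule applies to [flat_exp k] composed with an affine form. *)
Lemma is_derive_line (R : realType) (f : R * R -> R) (p v : R * R) (df : R) :
  is_derive (0 : R) 1 (fun h : R => f (h *: v + p)) df -> is_derive p v f df.
Proof.
move=> [dfp <-]; apply: DeriveDef; first by apply/derivable1P.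
apply: (congr1 (fun g : R -> R => lim (g x @[x --> (0 : R)^']))).
apply/funext => h /=.
by rewrite scale0r add0r addr0 [h *: 1]mulr1.
Qed.

Lemma continuous_affine (R : realType) (a b c : R) :
  continuous (fun p : R * R => a * p.1 + b * p.2 + c : R).
Proof.
move=> p; apply: cvgD; last exact: cvg_cst.
apply: cvgD.
  by apply: cvgM; [exact: cvg_cst|exact: cvg_fst].
by apply: cvgM; [exact: cvg_cst|exact: cvg_snd].
Qed.

Lemma flat_alg_continuous (R : realType) (u : R * R -> R) :
  flat_alg u -> continuous u.
Proof.
elim=> {u} [k a b c p|a u _ cu p|u v _ cu _ cv p|u v _ cu _ cv p].
- apply: (@continuous_comp _ _ _ (fun p : R * R => a * p.1 + b * p.2 + c)
             (flat_exp k)).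
    exact: continuous_affine.
  exact: continuous_flat_exp.
- by apply: cvgM; [exact: cvg_cst|exact: cu].
- by apply: cvgD; [exact: cu|exact: cv].
- by apply: cvgM; [exact: cu|exact: cv].
Qed.

Lemma flat_alg_measurable (R : realType) (u : R * R -> R) :
  flat_alg u ->
  measurable_fun [set: measurableTypeR R * measurableTypeR R] u.
Proof.
elim=> {u} [k a b c|a u _ mu|u v _ mu _ mv|u v _ mu _ mv].
- apply: (@measurableT_comp _ _ _ _ _ _ (flat_exp k)).
    by apply: continuous_measurable_fun; exact: continuous_flat_exp.
  apply: measurable_funD => //; apply: measurable_funD; apply: measurable_funM => //.
- by apply: measurable_funM.
- by apply: measurable_funD.
- by apply: measurable_funM.
Qed.

(** The derivative is produced as one function of the whole plane, so that
    function extensionality turns it into the next iterated partial. *)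
Lemma flat_alg_derive (R : realType) (b : bool) (u : R * R -> R) :
  flat_alg u -> exists2 du, flat_alg du &
    forall p : R * R, is_derive p (basis_vec R b) u (du p).
Proof.
elim=> {u} [k a1 a2 c|a u _ [du bdu du']|
            u v _ [du bdu du'] _ [dv bdv dv']|
            u v bu [du bdu du'] bv [dv bdv dv']].
- set s := if b then a2 else a1.
  exists (fun p => s * (flat_exp k.+2 (a1 * p.1 + a2 * p.2 + c)
                   + - k%:R * flat_exp k.+1 (a1 * p.1 + a2 * p.2 + c))).
    apply: flat_alg_scale; apply: flat_alg_add; first exact: flat_alg_flat_exp.
    apply: (flat_alg_scale (- k%:R)); exact: flat_alg_flat_exp.
  move=> p; apply: is_derive_line.
  set l := a1 * p.1 + a2 * p.2 + c.
  have -> : (fun h : R => flat_exp k (a1 * (h *: basis_vec R b + p).1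
     + a2 * (h *: basis_vec R b + p).2 + c)) = flat_exp k \o (fun h => h * s + l).
    apply/funext => h /=; congr (flat_exp k _).
    by rewrite /s /l; case: b {s}; rewrite /GRing.scale /=; ring.
  have dl : is_derive (0 : R) 1 (fun h : R => h * s + l) s.
    have H : is_derive (0 : R) 1 (fun h : R => h * s + l)
               (0 *: 0 + s *: 1 + 0).
      exact (is_deriveD (is_deriveM (is_derive_id _ _) (is_derive_cst _ _ _))
                        (is_derive_cst _ _ _)).
    by move: H; rewrite addr0 scale0r add0r [s *: 1]mulr1.
  have de : is_derive (0 * s + l) 1 (flat_exp k)
      (flat_exp k.+2 l - k%:R * flat_exp k.+1 l).
    by rewrite mul0r add0r; exact: is_derive_flat_exp.
  have := @is_derive1_comp R (flat_exp k) (fun h : R => h * s + l) 0 _ _ de dl.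
  rewrite mulrC mulNr; exact.
- exists (fun p => a * du p); first exact: flat_alg_scale.
  move=> p; exact (is_deriveZ a (du' p)).
- exists (fun p => du p + dv p); first exact: flat_alg_add.
  move=> p; exact (is_deriveD (du' p) (dv' p)).
- exists (fun p => u p * dv p + v p * du p).
    by apply: flat_alg_add; exact: flat_alg_mul.
  move=> p; exact (is_deriveM (du' p) (dv' p)).
Qed.

Lemma flat_alg_partials (R : realType) (w : seq bool) (u : R * R -> R) :
  flat_alg u -> flat_alg (partials w u).
Proof.
move=> bu; elim: w => [//|b w IH] /=.
have [du bdu du'] := flat_alg_derive b IH.
suff -> : (fun p => 'D_(basis_vec R b) (partials w u) p) = du by [].
apply/funext => p; exact: (@derive_val _ _ _ _ _ _ _ (du' p)).
Qed.

Lemma flat_alg_smooth (R : realType) (u : R * R -> R) : flat_alg u -> smooth u.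
Proof.
move=> bu w; have bw := flat_alg_partials w bu.
split=> [|b p]; first exact: flat_alg_continuous.
have [du _ du'] := flat_alg_derive b bw.
exact: (@ex_derive _ _ _ _ _ _ _ (du' p)).
Qed.

Lemma partials0 (R : realType) (w : seq bool) :
  partials w (cst 0 : R * R -> R) = cst 0.
Proof.
elim: w => //= b w ->; apply/funext => p; exact: derive_cst.
Qed.

Lemma smooth0 (R : realType) : smooth (cst 0 : R * R -> R).
Proof.
move=> w; rewrite partials0; split; first by move=> p; exact: cvg_cst.
by move=> b p; exact: derivable_cst.
Qed.

(** The complement of a closed set is open, so a function vanishing there
    vanishes near each of its points. *)
Lemma partials_supp (R : realType) (w : seq bool) (u : R * R -> R)
    (K : set (R * R)) :
  closed K -> (forall p, ~ K p -> u p = 0) ->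
  forall p, ~ K p -> partials w u p = 0.
Proof.
move=> cK u0; elim: w => [//|b w IH] p nKp /=.
rewrite (@near_eq_derive _ _ _ _ (cst 0)); first exact: derive_cst.
have : \near p, ~ K p by exact: open_nbhs_nbhs (conj (closed_openC cK) nKp).
by apply: filterS => q /IH.
Qed.

(** Each partial derivative is continuous and vanishes outside a compact square,
    so its product with any monomial attains a maximum. *)
Lemma schwartz_bump (R : realType) (u : R * R -> R) (B : R) :
  flat_alg u ->
  (forall p, u p != 0 -> `|p.1| <= B /\ `|p.2| <= B) ->
  schwartz (fun p => (u p)%:C%C).
Proof.
move=> bu u0; split; [exact: flat_alg_smooth|exact: smooth0|] => m n w.
set K : set (R * R) := [set` `[- B, B]] `*` [set` `[- B, B]].
have cK : compact K by apply: compact_setX; exact: segment_compact.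
have clK : closed K by apply: compact_closed => //; exact: order_hausdorff.
have wu0 p : ~ K p -> partials w u p = 0.
  apply: partials_supp => // {}p nKp; apply/eqP/negPn/negP => /u0 [h1 h2].
  by apply: nKp; split; rewrite /= in_itv /= -ler_norml.
have E p : Normc.normc (cpartials w (fun p => (u p)%:C%C) p) = `|partials w u p|.
  rewrite /cpartials /= (_ : (fun q : R * R => 0) = cst 0) // partials0.
  by rewrite expr0n addr0 sqrtr_sqr.
pose g (p : R * R) := `|p.1 ^+ m * p.2 ^+ n * partials w u p|.
have cg : continuous g.
  move=> p; apply: cvg_norm; apply: cvgM.
    apply: cvgM.
      apply: (@continuous_comp _ _ _ fst (fun x : R => x ^+ m)).
        exact: cvg_fst.
      exact: exprn_continuous.
    apply: (@continuous_comp _ _ _ snd (fun x : R => x ^+ n)).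
      exact: cvg_snd.
    exact: exprn_continuous.
  exact: flat_alg_continuous (flat_alg_partials w bu) p.
have [K0|K0] := pselect (K !=set0).
  have [c _ gc] := @compact_EVT_max _ R g K K0 cK (continuous_subspaceT cg).
  exists (g c) => p; rewrite E -normrM; have [Kp|nKp] := pselect (K p).
    by apply: gc; rewrite inE.
  by rewrite wu0 // mulr0 normr0 /g normr_ge0.
exists 0 => p; rewrite E wu0 ?normr0 ?mulr0 //.
by move=> Kp; apply: K0; exists p.
Qed.

(** * Lebesgue measure and Lp norms in the plane *)

Lemma normc_real (R : realType) (x : R) : Normc.normc (x%:C%C) = `|x|.
Proof. by rewrite /= expr0n addr0 sqrtr_sqr. Qed.

Lemma leb_cc (R : realType) (a b : R) : a <= b ->
  (@lebesgue_measure R [set` `[a, b]] = (b - a)%:E)%E.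
Proof.
move=> ab; rewrite lebesgue_measure_itv /= lte_fin.
case: (ltgtP a b) ab => // -> _; by rewrite subrr.
Qed.

Lemma leb_co (R : realType) (a b : R) : a <= b ->
  (@lebesgue_measure R [set` `[a, b[] = (b - a)%:E)%E.
Proof.
move=> ab; rewrite lebesgue_measure_itv /= lte_fin.
case: (ltgtP a b) ab => // -> _; by rewrite subrr.
Qed.

Lemma leb2_box (R : realType) (a b c d : R) : a <= b -> c <= d ->
  (@leb2 R ([set` `[a, b]] `*` [set` `[c, d]]) = ((b - a) * (d - c))%:E)%E.
Proof.
move=> ab cd; rewrite /leb2 /= product_measure1E; last 2 first.
  exact: measurable_itv.
  exact: measurable_itv.
by rewrite -[LHS]/(lebesgue_measure _ * lebesgue_measure _)%E !leb_cc // EFinM.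
Qed.

Definition diag_strip (R : realType) (a b c d : R) :
    set (measurableTypeR R * measurableTypeR R) :=
  [set p | p.1 \in `[a, b] /\ p.1 + p.2 \in `[c, d[].

Lemma measurable_diag_strip (R : realType) (a b c d : R) :
  measurable (diag_strip a b c d).
Proof.
have -> : diag_strip a b c d = (fst @^-1` [set` `[a, b]]) `&`
   ((fun p : measurableTypeR R * measurableTypeR R =>
       p.1 + p.2 : measurableTypeR R) @^-1` [set` `[c, d[]) by [].
apply: measurableI.
  rewrite -[X in measurable X]setTI; apply: measurable_fst => //.
have mD : measurable_fun [set: measurableTypeR R * measurableTypeR R]
    (fun p : measurableTypeR R * measurableTypeR R =>
       p.1 + p.2 : measurableTypeR R).
  by apply: measurable_funD.
rewrite -[X in measurable X]setTI; exact: mD.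
Qed.

(** The shear [(x, y) |-> (x, x + y)] preserves area: the section over [x] is the
    translate by [- x] of the interval for [x + y]. *)
Lemma leb2_diag_strip (R : realType) (a b c d : R) : a <= b -> c <= d ->
  (@leb2 R (diag_strip a b c d) = ((b - a) * (d - c))%:E)%E.
Proof.
move=> ab cd; rewrite /leb2 /=.
rewrite [LHS](_ : _ = \int[@lebesgue_measure R]_x
   ((d - c)%:E * (\1_([set` `[a, b]] : set R) x)%:E)%E)%E.
  rewrite ge0_integralZl //.
  - rewrite integral_indic // setIT.
    transitivity ((d - c)%:E * (b - a)%:E)%E; last by rewrite -EFinM mulrC.
    by congr (_ * _)%E; exact: leb_cc.
  - apply/measurable_EFinP; exact: measurable_indic.
  - by rewrite lee_fin subr_ge0.
apply: eq_integral => x _ /=.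
rewrite indicE; have [xab|xab] := boolP (x \in [set` `[a, b]]).
  rewrite mule1 (_ : d - c = (d - x) - (c - x)); last by ring.
  rewrite -(@leb_co R (c - x) (d - x)) ?lerD2r //.
  congr (lebesgue_measure _); apply/seteqP; split => y.
    rewrite /xsection /= inE => -[_]; rewrite /= !in_itv /= => /andP[h1 h2].
    by apply/andP; split; lra.
  rewrite /= in_itv /= => /andP[h1 h2]; rewrite /xsection /= inE; split => /=.
    by move: xab; rewrite inE.
  by rewrite in_itv /=; apply/andP; split; lra.
rewrite mule0 (_ : xsection _ _ = set0) ?measure0 //.
apply/seteqP; split => y //; rewrite /xsection /= inE => -[h _].
by move: xab; rewrite notin_setE.
Qed.

Lemma cLnormy_le1 (R : realType) (u : R * R -> R) :
  (forall p, `|u p| <= 1) -> (cLnorm +oo%E (fun p => (u p)%:C%C) <= 1)%E.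
Proof.
move=> u1; rewrite /cLnorm unlock; case: ifPn => // _.
apply/ess_supP; apply: nearW => p.
by rewrite /comp normc_real abse_EFin normr_id lee_fin u1.
Qed.

Lemma cLnorm_le_box (R : realType) (u : R * R -> R) (r a b c d : R) :
  0 < r -> a <= b -> c <= d ->
  measurable_fun [set: measurableTypeR R * measurableTypeR R] u ->
  (forall p, 0 <= u p <= 1) ->
  (forall p, u p != 0 -> p.1 \in `[a, b] /\ p.2 \in `[c, d]) ->
  (cLnorm r%:E (fun p => (u p)%:C%C) <= (((b - a) * (d - c)) `^ r^-1)%:E)%E.
Proof.
move=> r0 ab cd mu u01 usupp; rewrite /cLnorm unlock.
set Q : set (measurableTypeR R * measurableTypeR R) :=
  [set` `[a, b]] `*` [set` `[c, d]].
have mQ : measurable Q by apply: measurableX; exact: measurable_itv.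
have E : (\int[@leb2 R]_x (`|(Normc.normc (u x)%:C%C)%:E| `^ r)
         = \int[@leb2 R]_x ((u x) `^ r)%:E)%E.
  apply: eq_integral => x _; rewrite normc_real /= normr_id ger0_norm //.
  by case/andP: (u01 x).
have I : (\int[@leb2 R]_x ((u x) `^ r)%:E <= ((b - a) * (d - c))%:E)%E.
  rewrite -leb2_box // -/Q -[leRHS]mul1e -[X in (_ <= X * _)%E]/(1%:E).
  have <- : (\int[@leb2 R]_x (\1_Q x)%:E = 1 * leb2 R Q)%E.
    by rewrite integral_indic // setIT mul1e.
  apply: ge0_le_integral.
  - exact: measurableT.
  - by move=> x _; rewrite lee_fin powR_ge0.
  - apply/measurable_EFinP.
    by apply: (@measurableT_comp _ _ _ _ _ _ (fun x => x `^ r)).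
  - apply/measurable_EFinP; exact: measurable_indic.
  move=> x _; rewrite lee_fin indicE.
  have [u0|u0] := eqVneq (u x) 0.
    by rewrite u0 powR0 ?ler0n // gt_eqF.
  have [h1 h2] := usupp x u0.
  rewrite mem_set //; have /andP[h3 h4] := u01 x.
  apply: (@le_trans _ _ (1 `^ r)); last by rewrite powR1.
  by apply: ge0_ler_powR; rewrite ?nnegrE ?ler01 // ltW.
clear mu usupp mQ; rewrite E -poweR_EFin.
have r1 : 0 <= r^-1 by rewrite invr_ge0 ltW.
apply: (gt0_ler_poweR r1); last exact: I.
  rewrite in_itv /= leey andbT; apply: integral_ge0 => x _.
  by rewrite lee_fin powR_ge0.
by rewrite in_itv /= leey andbT lee_fin mulr_ge0 // subr_ge0.
Qed.

(** * The form when the truncation is eventually inactive *)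

Definition real_integrand (R : realType) (f g h : R * R -> R)
    (q : R * R * R) : R :=
  f (q.1.1, q.1.2) * g (q.1.2, q.2) * h (q.2, q.1.1) / (q.1.1 + q.1.2 + q.2).

Lemma thf_integrand_real (R : realType) (f g h : R * R -> R) (q : R * R * R) :
  thf_integrand (fun p => (f p)%:C%C) (fun p => (g p)%:C%C)
    (fun p => (h p)%:C%C) q = (real_integrand f g h q)%:C%C.
Proof.
by case: q => [[x y] z]; rewrite /thf_integrand /real_integrand /=
  -!rmorphM -fmorphV -rmorphM.
Qed.

Lemma thf_trunc_real (R : realType) (f g h : R * R -> R) (eps : R) :
  (forall q, real_integrand f g h q != 0 ->
     eps <= `|q.1.1 + q.1.2 + q.2| <= eps^-1) ->
  thf_trunc (fun p => (f p)%:C%C) (fun p => (g p)%:C%C)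
    (fun p => (h p)%:C%C) eps
  = (Rintegral (@leb3 R) setT (real_integrand f g h))%:C%C.
Proof.
move=> supp; rewrite /thf_trunc /cintegral3.
set D := [set q | _].
have -> : Rintegral (@leb3 R) D (fun q => complex.Im (thf_integrand
    (fun p => (f p)%:C%C) (fun p => (g p)%:C%C) (fun p => (h p)%:C%C) q)) = 0.
  under eq_Rintegral do rewrite thf_integrand_real /=.
  by rewrite /Rintegral integral0.
congr (_ +i* _)%C.
under eq_Rintegral do rewrite thf_integrand_real /=.
rewrite Rintegral_mkcond; congr (Rintegral _ _ _); apply/funext => q.
rewrite patchE; case: ifPn => // nD; apply/esym/eqP; apply: contraNT nD.
by move=> /supp hq; rewrite inE.
Qed.

(** If the integrand vanishes near the plane [x + y + z = 0] and far from it,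
    small truncations do not remove anything, so the principal value is an
    ordinary integral. *)
Lemma thf_real (R : realType) (f g h : R * R -> R) (d : R) :
  0 < d ->
  (forall q, real_integrand f g h q != 0 ->
     d <= `|q.1.1 + q.1.2 + q.2| <= d^-1) ->
  let F p := (f p)%:C%C in let G p := (g p)%:C%C in let H p := (h p)%:C%C in
  cvg ((thf_trunc F G H eps : R[i]^o) @[eps --> 0^'+]) /\
  thf F G H = (Rintegral (@leb3 R) setT (real_integrand f g h))%:C%C.
Proof.
move=> d0 supp F G H.
have E : \forall eps \near (0 : R)^'+, (thf_trunc F G H eps : R[i]^o)
   = (Rintegral (@leb3 R) setT (real_integrand f g h))%:C%C.
  near=> eps; apply: thf_trunc_real => q /supp /andP[h1 h2].
  have e0 : 0 < eps by near: eps; exact: nbhs_right_gt.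
  have ed : eps <= d by near: eps; exact: nbhs_right_le.
  rewrite (le_trans ed h1) (le_trans h2) // lef_pV2 //.
split; first exact: is_cvg_near_cst E.
exact: norm_lim_near_cst E.
Unshelve. all: by end_near. Qed.

(** * The test functions *)

Definition bump (R : realType) (a b t : R) : R :=
  flat_exp 0 (t - a) * flat_exp 0 (b - t).

Lemma bump_ge0 (R : realType) (a b t : R) : 0 <= bump a b t.
Proof. by rewrite mulr_ge0 // flat_exp_ge0. Qed.

Lemma bump_le1 (R : realType) (a b t : R) : bump a b t <= 1.
Proof. by rewrite mulr_ile1 ?flat_exp_ge0 ?flat_exp0_le1. Qed.

Lemma bump_supp (R : realType) (a b t : R) : bump a b t != 0 -> a < t < b.
Proof.
rewrite /bump mulf_eq0 negb_or => /andP[h1 h2]; apply/andP; split.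
  by rewrite ltNge; apply: contraNN h1 => h; rewrite flat_exp_neg // subr_le0.
by rewrite ltNge; apply: contraNN h2 => h; rewrite flat_exp_neg // subr_le0.
Qed.

(** A lower bound at distance [s] from both end points, uniform in the length of
    the interval: this is why bumps are not rescaled copies of a single one. *)
Lemma bump_ge (R : realType) (a b s t : R) :
  a + s <= t -> t <= b - s -> flat_exp 0 s ^+ 2 <= bump a b t.
Proof.
by move=> h1 h2; rewrite expr2 ler_pM ?flat_exp_ge0 // flat_exp0_homo //; lra.
Qed.

Lemma bump_gt0 (R : realType) (a b t : R) : a < t -> t < b -> 0 < bump a b t.
Proof. by move=> h1 h2; rewrite mulr_gt0 // flat_exp0_gt0 // subr_gt0. Qed.

Lemma flat_alg_bump (R : realType) (a b c d : R) :
  flat_alg (fun p => bump a b (c * p.1 + d * p.2)).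
Proof.
apply: flat_alg_mul; first exact: flat_alg_flat_exp.
rewrite (_ : (fun p : R * R => flat_exp 0 (b - (c * p.1 + d * p.2))) =
  fun p => flat_exp 0 (- c * p.1 + - d * p.2 + b)); first exact: flat_alg_flat_exp.
by apply/funext => p; congr (flat_exp 0 _); ring.
Qed.

Lemma measurable_bump (R : realType) (a b : R) :
  measurable_fun [set: measurableTypeR R] (bump a b : R -> measurableTypeR R).
Proof.
apply: continuous_measurable_fun => t.
apply: cvgM.
  apply: (@continuous_comp _ _ _ (fun t : R => t - a) (flat_exp 0));
    last exact: continuous_flat_exp.
  by apply: cvgB; [exact: cvg_id|exact: cvg_cst].
apply: (@continuous_comp _ _ _ (fun t : R => b - t) (flat_exp 0));
  last exact: continuous_flat_exp.
by apply: cvgB; [exact: cvg_cst|exact: cvg_id].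
Qed.

(** The second factor keeps [x + y + z] positive and away from [0] for [z] in
    [(0, 1)]. The first one makes the support compact; as the third function of
    the form carries the same cutoff in [x], it does not shrink the region of
    integration. *)
Definition strip_bump (R : realType) (N : R) (p : R * R) : R :=
  bump 0 N p.1 * bump 1 N (p.1 + p.2).

Definition box_bump (R : realType) (a b c d : R) (p : R * R) : R :=
  bump a b p.1 * bump c d p.2.

Lemma flat_alg_strip_bump (R : realType) (N : R) : flat_alg (strip_bump N).
Proof.
rewrite (_ : strip_bump N = fun p =>
   bump 0 N (1 * p.1 + 0 * p.2) * bump 1 N (1 * p.1 + 1 * p.2)).
  by apply: flat_alg_mul; exact: flat_alg_bump.
by apply/funext => p; rewrite !mul1r mul0r addr0.
Qed.

Lemma flat_alg_box_bump (R : realType) (a b c d : R) :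
  flat_alg (box_bump a b c d).
Proof.
rewrite (_ : box_bump a b c d = fun p =>
   bump a b (1 * p.1 + 0 * p.2) * bump c d (0 * p.1 + 1 * p.2)).
  by apply: flat_alg_mul; exact: flat_alg_bump.
by apply/funext => p; rewrite !mul1r !mul0r addr0 add0r.
Qed.

Lemma strip_bump01 (R : realType) (N : R) p : 0 <= strip_bump N p <= 1.
Proof. by rewrite mulr_ge0 ?bump_ge0 //= mulr_ile1 ?bump_ge0 ?bump_le1. Qed.

Lemma box_bump01 (R : realType) (a b c d : R) p : 0 <= box_bump a b c d p <= 1.
Proof. by rewrite mulr_ge0 ?bump_ge0 //= mulr_ile1 ?bump_ge0 ?bump_le1. Qed.

Lemma strip_bump_supp (R : realType) (N : R) p :
  strip_bump N p != 0 -> 0 < p.1 < N /\ 1 < p.1 + p.2 < N.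
Proof. by rewrite mulf_eq0 negb_or => /andP[/bump_supp ? /bump_supp ?]. Qed.

Lemma box_bump_supp (R : realType) (a b c d : R) p :
  box_bump a b c d p != 0 -> a < p.1 < b /\ c < p.2 < d.
Proof. by rewrite mulf_eq0 negb_or => /andP[/bump_supp ? /bump_supp ?]. Qed.

Lemma schwartz_strip_bump (R : realType) (N : R) :
  schwartz (fun p => (strip_bump N p)%:C%C).
Proof.
apply: (@schwartz_bump _ _ N); first exact: flat_alg_strip_bump.
move=> p /strip_bump_supp[/andP[h1 h2] /andP[h3 h4]].
by rewrite !ler_norml; split; apply/andP; split; lra.
Qed.

Lemma schwartz_box_bump (R : realType) (a b c d : R) :
  schwartz (fun p => (box_bump a b c d p)%:C%C).
Proof.
apply: (@schwartz_bump _ _ (`|a| + `|b| + `|c| + `|d|)).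
  exact: flat_alg_box_bump.
move=> p /box_bump_supp[/andP[h1 h2] /andP[h3 h4]].
have /ler_normlP[a1 a2] := lexx `|a|; have /ler_normlP[b1 b2] := lexx `|b|.
have /ler_normlP[c1 c2] := lexx `|c|; have /ler_normlP[d1 d2] := lexx `|d|.
have ha := normr_ge0 a; have hb := normr_ge0 b.
have hc := normr_ge0 c; have hd := normr_ge0 d.
by rewrite !ler_norml; split; apply/andP; split; lra.
Qed.

Definition test_integrand (R : realType) (N : R) : R * R * R -> R :=
  real_integrand (strip_bump N) (box_bump (- N) N 0 1) (box_bump 0 1 0 N).

Lemma test_integrand_supp (R : realType) (N : R) q :
  test_integrand N q != 0 ->
  [/\ 0 < q.1.1 < N, - N < q.1.2 < N, 0 < q.2 < 1 & 1 < q.1.1 + q.1.2 < N].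
Proof.
rewrite /test_integrand /real_integrand.
rewrite mulf_eq0 negb_or => /andP[+ _]; rewrite mulf_eq0 negb_or => /andP[+ _].
by rewrite mulf_eq0 negb_or => /andP[/strip_bump_supp[? ?] /box_bump_supp[? ?]].
Qed.

Lemma test_integrand_ge0 (R : realType) (N : R) q : 0 <= test_integrand N q.
Proof.
have [->//|h] := eqVneq (test_integrand N q) 0.
have [_ _ /andP[z0 _] /andP[u1 _]] := test_integrand_supp h.
have := strip_bump01 N (q.1.1, q.1.2) => /andP[f0 _].
have := box_bump01 (- N) N 0 1 (q.1.2, q.2) => /andP[g0 _].
have := box_bump01 0 1 0 N (q.2, q.1.1) => /andP[h0 _].
apply: mulr_ge0; first exact: mulr_ge0 (mulr_ge0 f0 g0) h0.
by rewrite invr_ge0; lra.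
Qed.

Lemma test_integrand_le1 (R : realType) (N : R) q : test_integrand N q <= 1.
Proof.
have [->//|h] := eqVneq (test_integrand N q) 0.
have [_ _ /andP[z0 _] /andP[u1 _]] := test_integrand_supp h.
have := strip_bump01 N (q.1.1, q.1.2) => /andP[f0 f1].
have := box_bump01 (- N) N 0 1 (q.1.2, q.2) => /andP[g0 g1].
have := box_bump01 0 1 0 N (q.2, q.1.1) => /andP[h0 h1].
rewrite /test_integrand /real_integrand ler_pdivrMr ?mul1r; last by lra.
apply: (@le_trans _ _ 1); last by lra.
exact: mulr_ile1 (mulr_ge0 f0 g0) h0 (mulr_ile1 f0 g0 f1 g1) h1.
Qed.

Lemma measurable_test_integrand (R : realType) (N : R) :
  measurable_fun
    [set: measurableTypeR R * measurableTypeR R * measurableTypeR R]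
    (test_integrand N).
Proof.
set T3 := (measurableTypeR R * measurableTypeR R * measurableTypeR R)%type.
have mx : measurable_fun [set: T3] (fun q : T3 => q.1.1).
  exact: measurableT_comp measurable_fst measurable_fst.
have my : measurable_fun [set: T3] (fun q : T3 => q.1.2).
  exact: measurableT_comp measurable_snd measurable_fst.
have mz : measurable_fun [set: T3] (fun q : T3 => q.2).
  exact: measurable_snd.
have mu : measurable_fun [set: T3] (fun q : T3 => q.1.1 + q.1.2 : measurableTypeR R).
  exact: measurable_funD.
have mb a b (l : T3 -> R) : measurable_fun [set: T3] (l : T3 -> measurableTypeR R) ->
    measurable_fun [set: T3] (fun q => bump a b (l q) : measurableTypeR R).
  move=> ml; apply: (@measurableT_comp _ _ _ _ _ _ (bump a b)) => //.
  exact: measurable_bump.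
(* On the support the denominator is positive, so its inverse may be replaced
   by a real power, which is measurable on the whole line. *)
rewrite (_ : test_integrand N = fun q : T3 =>
  bump 0 N q.1.1 * bump 1 N (q.1.1 + q.1.2) * (bump (- N) N q.1.2 * bump 0 1 q.2)
   * (bump 0 1 q.2 * bump 0 N q.1.1) * (q.1.1 + q.1.2 + q.2) `^ (- 1)).
  apply: measurable_funM; last first.
    apply: (@measurableT_comp _ _ _ _ _ _ (fun x => x `^ (- 1))) => //.
    exact: measurable_funD.
  by apply: measurable_funM; [apply: measurable_funM|];
    apply: measurable_funM; exact: mb.
apply/funext => q.
have E : test_integrand N q =
  bump 0 N q.1.1 * bump 1 N (q.1.1 + q.1.2) * (bump (- N) N q.1.2 * bump 0 1 q.2)
   * (bump 0 1 q.2 * bump 0 N q.1.1) / (q.1.1 + q.1.2 + q.2) by [].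
have [F0|F0] := eqVneq (bump 0 N q.1.1 * bump 1 N (q.1.1 + q.1.2)
   * (bump (- N) N q.1.2 * bump 0 1 q.2)
   * (bump 0 1 q.2 * bump 0 N q.1.1)) 0.
  by rewrite E F0 !mul0r.
rewrite E; congr (_ * _); rewrite powR_inv1 //.
move: F0; rewrite mulf_eq0 negb_or => /andP[+ _].
rewrite mulf_eq0 negb_or => /andP[].
move=> /(@strip_bump_supp _ _ (q.1.1, q.1.2))[_ /andP[u1 _]].
move=> /(@box_bump_supp _ _ _ _ _ (q.1.2, q.2))[_ /andP[z0 _]].
by move: u1 z0 => /= u1 z0; lra.
Qed.

(** * Logarithmic growth *)

(** A region on which [x + y] has size [2 ^ (k + 1)]. As long as
    [2 ^ (k + 2) <= N - 1], the margins keep the argument of every bump in the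
    integrand at distance at least [1 / 4] from the end points. *)
Definition block (R : realType) (N : R) (k : nat) :
    set (measurableTypeR R * measurableTypeR R * measurableTypeR R) :=
  diag_strip 1 (N - 1) (2 ^+ k.+1) (2 ^+ k.+2) `*` [set` `[4^-1, 3 / 4]].

Lemma measurable_block (R : realType) (N : R) k : measurable (block N k).
Proof.
apply: measurableX; [exact: measurable_diag_strip|exact: measurable_itv].
Qed.

Lemma leb3_block (R : realType) (N : R) k : 2 <= N ->
  (@leb3 R (block N k) = ((N - 2) * 2 ^+ k.+1 / 2)%:E)%E.
Proof.
move=> N2; rewrite /leb3 /= product_measure1E; last 2 first.
  exact: measurable_diag_strip.
  exact: measurable_itv.
rewrite -[X in (X * _)%E]/(@leb2 R _) leb2_diag_strip; last 2 first.
  by lra.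
  by rewrite ler_eXn2l // ltr1n.
rewrite -[X in (_ * X)%E]/(@lebesgue_measure R _) leb_cc; last by lra.
by rewrite -EFinM (exprS _ k.+1); congr (_%:E); field.
Qed.

Lemma block_disjoint (R : realType) (N : R) j k q :
  block N j q -> block N k q -> j = k.
Proof.
suff H i l : block N i q -> block N l q -> (i <= l)%N.
  by move=> hj hk; apply/eqP; rewrite eqn_leq !H.
move=> [[_ +] _] [[_ +] _]; rewrite !in_itv /= => /andP[h1 _] /andP[_ h2].
have := le_lt_trans h1 h2; rewrite ltr_eXn2l ?ltr1n //.
Qed.

(** Six bumps, each at least [flat_exp 0 (1 / 4) ^ 2]; the factor [4] comes from
    [x + y + z < 4 * 2 ^ (k + 1)] on the block of index [k]. *)
Definition block_floor (R : realType) : R := (flat_exp 0 (4^-1 : R) ^+ 2) ^+ 6 / 4.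

Lemma block_floor_gt0 (R : realType) : 0 < block_floor R.
Proof. by rewrite divr_gt0 // !exprn_gt0 // flat_exp0_gt0 // invr_gt0. Qed.

Lemma test_integrand_block (R : realType) (N : R) k q :
  2 ^+ k.+2 <= N - 1 -> block N k q ->
  block_floor R / 2 ^+ k.+1 <= test_integrand N q.
Proof.
move=> kN [[]]; rewrite /= !in_itv /=.
move=> /andP[x1 x2] /andP[u1 u2] /andP[z1 z2].
have s2 : (2 : R) <= 2 ^+ k.+1 by rewrite exprS ler_peMr // exprn_ege1 // ler1n.
have s4 : (2 : R) ^+ k.+2 = 2 * 2 ^+ k.+1 by rewrite exprS.
rewrite s4 in kN u2.
set s := (2 : R) ^+ k.+1 in s2 kN u1 u2 *.
have t0 : 0 < q.1.1 + q.1.2 + q.2 by lra.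
pose e : R := flat_exp 0 (4^-1 : R) ^+ 2.
have e0 : 0 <= e by rewrite exprn_ge0 // flat_exp_ge0.
have bx : e <= bump 0 N q.1.1 by apply: bump_ge; lra.
have bu : e <= bump 1 N (q.1.1 + q.1.2) by apply: bump_ge; lra.
have bY : e <= bump (- N) N q.1.2 by apply: bump_ge; lra.
have bz : e <= bump 0 1 q.2 by apply: bump_ge; lra.
have ee0 : 0 <= e * e by rewrite mulr_ge0.
rewrite /block_floor -/e -mulrA -invfM ler_pdivrMr; last by lra.
rewrite /test_integrand /real_integrand mulrAC ler_pdivlMr //.
apply: ler_pM; [by rewrite exprn_ge0|by lra| |by lra].
rewrite (_ : e ^+ 6 = e * e * (e * e) * (e * e)); last by ring.
apply: ler_pM => //; [by rewrite mulr_ge0| |by apply: ler_pM].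
by apply: ler_pM => //; apply: ler_pM.
Qed.

(** The volume of a block compensates the size of the kernel on it, so all
    scales contribute equally, and the number of admissible scales grows like
    [log N]. *)
Lemma test_integral_ge (R : realType) (N : R) (K : nat) :
  2 ^+ K.+1 <= N - 1 ->
  ((K%:R * (block_floor R * (N - 2) / 2))%:E
    <= \int[@leb3 R]_q (test_integrand N q)%:E)%E.
Proof.
move=> KN.
have N2 : 2 <= N.
  suff : (1 : R) <= 2 ^+ K.+1 by lra.
  by rewrite exprn_ege1 // ler1n.
pose w (k : nat) : R := block_floor R / 2 ^+ k.+1.
have w0 k : 0 <= w k by rewrite divr_ge0 ?exprn_ge0 // ltW // block_floor_gt0.
pose step (k : 'I_K) q : \bar R := ((w k)%:E * (\1_(block N k) q)%:E)%E.
have mstep k : measurable_fun setT (step k).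
  apply: emeasurable_funM => //; apply/measurable_EFinP.
  by apply: measurable_indic; exact: measurable_block.
have step0 k q : (0 <= step k q)%E by rewrite mule_ge0 // lee_fin.
have I k : (\int[@leb3 R]_q step k q = (block_floor R * (N - 2) / 2)%:E)%E.
  rewrite ge0_integralZl_EFin //; last first.
    by apply/measurable_EFinP; apply: measurable_indic; exact: measurable_block.
  rewrite integral_indic //; last exact: measurable_block.
  rewrite setIT leb3_block // -EFinM /w; congr (_%:E).
  by field; rewrite expf_neq0.
have -> : ((K%:R * (block_floor R * (N - 2) / 2))%:E
    = \int[@leb3 R]_q (\sum_(k < K) step k q))%E.
  rewrite ge0_integral_sum //; under eq_bigr do rewrite I.
  by rewrite sumEFin sumr_const card_ord mulr_natl.
apply: ge0_le_integral.
- exact: measurableT.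
- by move=> q _; apply: sume_ge0.
- by apply: emeasurable_sum.
- by apply/measurable_EFinP; exact: measurable_test_integrand.
move=> q _.
(* The blocks are disjoint: at most one term of the sum is nonzero at [q]. *)
have [[k bk]|nb] := pselect (exists k : 'I_K, block N k q).
  rewrite (bigD1 k) //= big1 ?adde0 => [|j jk].
    rewrite /step indicE mem_set // mule1 lee_fin.
    apply: test_integrand_block => //; apply: le_trans KN.
    by rewrite ler_eXn2l ?ltr1n // ltnS.
  rewrite /step indicE memNset ?mule0 // => bj.
  by move/eqP: jk; apply; apply: val_inj; exact: block_disjoint bj bk.
rewrite big1 ?lee_fin ?test_integrand_ge0 // => k _.
by rewrite /step indicE memNset ?mule0 // => bk; apply: nb; exists k.
Qed.

(** The integral has to be finite for its real value, which is [0] for an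
    infinite integral, to inherit the lower bound. *)
Lemma test_integral_fin (R : realType) (N : R) : 0 <= N ->
  (\int[@leb3 R]_q (test_integrand N q)%:E < +oo)%E.
Proof.
move=> N0.
set Q : set (measurableTypeR R * measurableTypeR R * measurableTypeR R) :=
  ([set` `[0, N]] `*` [set` `[- N, N]]) `*` [set` `[0, 1]].
have mQ : measurable Q.
  by apply: measurableX; [apply: measurableX|]; exact: measurable_itv.
apply: (@le_lt_trans _ _ (\int[@leb3 R]_q (\1_Q q)%:E)%E).
  apply: ge0_le_integral.
  - exact: measurableT.
  - by move=> q _; rewrite lee_fin test_integrand_ge0.
  - by apply/measurable_EFinP; exact: measurable_test_integrand.
  - by apply/measurable_EFinP; exact: measurable_indic.
  move=> q _; rewrite lee_fin indicE.
  have [->|h] := eqVneq (test_integrand N q) 0; first by rewrite ler0n.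
  have [x1 y1 z1 _] := test_integrand_supp h.
  rewrite mem_set ?test_integrand_le1 //.
  by split; [split|]; rewrite /= in_itv /= //; lra.
rewrite integral_indic // setIT /leb3 /= product_measure1E; last 2 first.
  by apply: measurableX; exact: measurable_itv.
  exact: measurable_itv.
rewrite -[X in (X * _)%E]/(@leb2 R _) leb2_box; last 2 first.
  by [].
  by lra.
rewrite -[X in (_ * X)%E]/(@lebesgue_measure R _) leb_cc; last by lra.
by rewrite -EFinM ltry.
Qed.

(** * Unboundedness *)

Lemma exists_large_test_integral (R : realType) (C : R) : 0 <= C ->
  exists2 N : R, 4 <= N &
    2 * C * N <= Rintegral (@leb3 R) setT (test_integrand N).
Proof.
move=> C0; have c0 := block_floor_gt0 R.
(* With [c] the block floor, the form is at least [K * c * (N - 2) / 2], which is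
   at least [K * c * N / 4] once [N >= 4]: hence the constant [8]. *)
have [K KC] : exists K : nat, 8 * C <= K%:R * block_floor R.
  exists (Num.bound (8 * C / block_floor R)).
  rewrite -ler_pdivrMr //; apply: ltW; apply: archi_boundP.
  by apply: divr_ge0; [lra|exact: ltW].
have [N N4 KN] : exists2 N : R, 4 <= N & 2 ^+ K.+1 <= N - 1.
  exists (2 ^+ K.+1 + 2); last by lra.
  rewrite exprS; have : (1 : R) <= 2 ^+ K by rewrite exprn_ege1 // ler1n.
  by lra.
exists N => //.
have I_ge := test_integral_ge KN.
have I_fin : (\int[@leb3 R]_q (test_integrand N q)%:E < +oo)%E.
  by apply: test_integral_fin; lra.
apply: (@le_trans _ _ (K%:R * (block_floor R * (N - 2) / 2))).
  have : 8 * C * (N - 2) <= K%:R * block_floor R * (N - 2).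
    by rewrite ler_pM2r //; lra.
  have : 0 <= C * (N - 4) by rewrite mulr_ge0 // subr_ge0.
  by clear; lra.
rewrite -lee_fin /Rintegral fineK // ge0_fin_numE //.
by apply: integral_ge0 => q _; rewrite lee_fin test_integrand_ge0.
Qed.

Lemma thf_test (R : realType) (N : R) : 0 < N ->
  let F p := (strip_bump N p)%:C%C in
  let G p := (box_bump (- N) N 0 1 p)%:C%C in
  let H p := (box_bump 0 1 0 N p)%:C%C in
  cvg ((thf_trunc F G H eps : R[i]^o) @[eps --> 0^'+]) /\
  thf F G H = (Rintegral (@leb3 R) setT (test_integrand N))%:C%C.
Proof.
(* On the support of the integrand [x + y + z] lies between [1] and [N + 1]. *)
move=> N0; apply: (@thf_real _ _ _ _ (N + 1)^-1); first by rewrite invr_gt0; lra.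
move=> q /test_integrand_supp[_ _ /andP[z0 z1] /andP[u0 u1]].
rewrite invrK ger0_norm; last by lra.
apply/andP; split; last by lra.
apply: (@le_trans _ _ 1); last by lra.
by rewrite invf_le1; lra.
Qed.

(** Both functions are at most [1], on boxes of area at most [2 * N]; this is where
    the exponents being conjugate makes the power of [N] exactly one. *)
Lemma test_norms_le (R : realType) (p2 p3 N : R) :
  1 < p2 -> 1 < p3 -> p2^-1 + p3^-1 = 1 -> 0 < N ->
  (cLnorm p2%:E (fun p => (box_bump (- N) N 0 1 p)%:C%C) *
   cLnorm p3%:E (fun p => (box_bump 0 1 0 N p)%:C%C) <= (2 * N)%:E)%E.
Proof.
move=> hp2 hp3 hp N0.
have NG : (cLnorm p2%:E (fun p => (box_bump (- N) N 0 1 p)%:C%C)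
           <= ((2 * N) `^ p2^-1)%:E)%E.
  rewrite (_ : 2 * N = (N - (- N)) * (1 - 0)); last by ring.
  apply: cLnorm_le_box; [lra|lra|lra| |exact: box_bump01|].
    by apply: flat_alg_measurable; exact: flat_alg_box_bump.
  move=> p /box_bump_supp[/andP[? ?] /andP[? ?]].
  by rewrite !in_itv /=; split; lra.
have NH : (cLnorm p3%:E (fun p => (box_bump 0 1 0 N p)%:C%C)
           <= ((2 * N) `^ p3^-1)%:E)%E.
  (* A box twice as large as the support gives the same bound as for the other
     function, so that the two powers add up. *)
  rewrite (_ : 2 * N = (1 - 0) * (N - (- N))); last by ring.
  apply: cLnorm_le_box; [lra|lra|lra| |exact: box_bump01|].
    by apply: flat_alg_measurable; exact: flat_alg_box_bump.
  move=> p /box_bump_supp[/andP[? ?] /andP[? ?]].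
  by rewrite !in_itv /=; split; lra.
apply: (le_trans (lee_pmul (Lnorm_ge0 _ _ _) (Lnorm_ge0 _ _ _) NG NH)).
rewrite -EFinM lee_fin -powRD; last by apply/implyP => _; lra.
by rewrite hp powRr1 //; lra.
Qed.

Theorem theorem1p4 (R : realType) (p1 : \bar R) (p2 p3 : R) (C : R)
    (hp1 : p1 = +oo%E) (hp2 : 1 < p2) (hp3 : 1 < p3)
    (hp : p2^-1 + p3^-1 = 1) :
  exists F G H : R * R -> R[i],
    [/\ [/\ schwartz F, schwartz G & schwartz H],
        [/\ exists q : R * R, F q != 0,
            exists q : R * R, G q != 0 &
            exists q : R * R, H q != 0],
        cvg ((thf_trunc F G H eps : R[i]^o) @[eps --> 0^'+]) &
        (C%:E * cLnorm p1 F * cLnorm p2%:E G * cLnorm p3%:E H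
           <= (Normc.normc (thf F G H))%:E)%E].
Proof.
subst p1.
(* The inequality for a negative constant follows from the one for [0]. *)
pose C' := Num.max C 0.
have C'0 : 0 <= C' by rewrite le_max lexx orbT.
have [N N4 main] := exists_large_test_integral C'0.
have N0 : 0 < N by lra.
have [cvgL thfE] := thf_test N0.
have NGH := test_norms_le hp2 hp3 hp N0.
exists (fun p => (strip_bump N p)%:C%C), (fun p => (box_bump (- N) N 0 1 p)%:C%C),
  (fun p => (box_bump 0 1 0 N p)%:C%C).
have nz (x : R) : 0 < x -> x%:C%C != 0 by move=> x0; rewrite fmorph_eq0 gt_eqF.
split => //.
- split; [exact: schwartz_strip_bump|exact: schwartz_box_bump|].
  exact: schwartz_box_bump.
- split; [exists (1, 1)|exists (0, 2^-1)|exists (2^-1, 1)];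
    by apply: nz; apply: mulr_gt0; apply: bump_gt0 => /=;
    move: N4; clear; lra.
rewrite thfE normc_real.
set F := fun p => _; set G := (X in cLnorm p2%:E X).
set H := (X in cLnorm p3%:E X).
have NF : (cLnorm +oo%E F <= 1)%E.
  apply: cLnormy_le1 => p; have /andP[f0 f1] := strip_bump01 N p.
  by rewrite ger0_norm.
apply: (@le_trans _ _ (2 * C' * N)%:E); last first.
  by rewrite lee_fin (le_trans main) // ler_norm.
rewrite (_ : 2 * C' * N = C' * (2 * N)); last by ring.
rewrite -muleA EFinM.
have CF : (C%:E * cLnorm +oo%E F <= C'%:E)%E.
  apply: (@le_trans _ _ (C'%:E * cLnorm +oo%E F)%E).
    by apply: lee_wpmul2r; [exact: Lnorm_ge0|rewrite lee_fin le_max lexx].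
  by rewrite -[leRHS]mule1; apply: lee_wpmul2l; rewrite // lee_fin.
apply: (@le_trans _ _ (C'%:E * (cLnorm p2%:E G * cLnorm p3%:E H))%E).
  by apply: lee_wpmul2r => //; apply: mule_ge0; exact: Lnorm_ge0.
by apply: lee_wpmul2l => //; rewrite lee_fin.
Qed.
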